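(* Let $\mathcal{A}=(a_{i_1\ldots i_k})$ be a weakly irreducible symmetric tensor of order $k\ge 2$ and dimension $n\ge 2$ (with complex entries) such that $a_{i_1\ldots i_k}\ne 0$ only when the indices $i_1,\ldots,i_k$ are either all equal or pairwise distinct. For every $k$-set $e=\{i_1,\ldots,i_k\}\subseteq[n]$ corresponding to a nonzero off-diagonal entry, define $c_e=(k-1)!\,a_{i_1\ldots i_k}$ (well defined because $\mathcal{A}$ is symmetric). Let $\lambda$ be an eigenvalue of $\mathcal{A}$, and let $p\in\mathbb{V}_\lambda(\mathcal{A})$ be an isolated point. Suppose that (1) $p$ has no zero entries; (2) there is an $\alpha\in\mathbb{R}$ such that $c_ep^e=|c_ep^e|e^{\mathbf{i}\alpha}$ for every such $k$-set $e$, where $p^e=\prod_{i\in e}p_i$ and $\mathbf{i}=\sqrt{-1}$. Then the local intersection multiplicity of $p$ with respect to the homogeneous eigen-equation ideal defining $\mathbb{V}_\lambda(\mathcal{A})$ is $1$.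
   Context: Let $[n]=\{1,\ldots,n\}$. A tensor $\mathcal{A}=(a_{i_1\ldots i_k})$ of order $k$ and dimension $n$ is an array of entries $a_{i_1\ldots i_k}\in\mathbb{C}$, $i_1,\ldots,i_k\in[n]$; it is symmetric if its entries are invariant under all permutations of the indices. For $x\in\mathbb{C}^n$, $(\mathcal{A}x^{k-1})_i=\sum_{i_2,\ldots,i_k\in[n]}a_{ii_2\ldots i_k}x_{i_2}\cdots x_{i_k}$, and $x^{[k-1]}=(x_1^{k-1},\ldots,x_n^{k-1})$. A number $\lambda\in\mathbb{C}$ is an eigenvalue of $\mathcal{A}$ if $\mathcal{A}x^{k-1}=\lambda x^{[k-1]}$ for some $x\in\mathbb{C}^n\setminus\{0\}$. The projective eigenvariety is $\mathbb{V}_\lambda(\mathcal{A})=\{x\in\mathbb{P}^{n-1}:\mathcal{A}x^{k-1}=\lambda x^{[k-1]}\}$, with $\mathbb{P}^{n-1}$ complex projective space. (Conditions (1) and (2) refer to a representative vector of $p$; they do not depend on its choice, up to a common change of $\alpha$.) The directed graph $D(\mathcal{A})$ has vertices $1,\ldots,n$ and an arc $(i,j)$ if and only if there is a nonzero entry $a_{ii_2\ldots i_k}$ with $j\in\{i_2,\ldots,i_k\}$. The tensor $\mathcal{A}$ is weakly irreducible if $D(\mathcal{A})$ is strongly connected. The homogeneous eigen-equation ideal is generated by $F_i=\lambda x_i^{k-1}-(\mathcal{A}x^{k-1})_i$, $i\in[n]$. The local intersection multiplicity of an isolated point $p$ is computed on any affine chart containing $p$: if $p_j\ne 0$, normalize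 $p_j=1$, let $f_i$ be obtained from $F_i$ by setting $x_j=1$, let $\tilde p\in\mathbb{C}^{n-1}$ be $p$ with the $j$-th coordinate removed, let $S=\mathbb{C}[x_i: i\in[n]\setminus\{j\}]$ and let $M_{\tilde p}$ be the maximal ideal of $S$ corresponding to $\tilde p$; then the multiplicity is $\dim_{\mathbb{C}} S_{M_{\tilde p}}/\langle f_1,\ldots,f_n\rangle S_{M_{\tilde p}}$. It does not depend on the chart. *)

(* Defs.v *)
From HB Require Import structures.
From mathcomp Require Import all_boot all_order all_fingroup all_algebra.
From mathcomp Require Import fraction complex mpoly reals.
(* Not imported: the notations of mpoly and of the analysis library clash. *)
From mathcomp Require trigo.

Set Implicit Arguments.
Unset Strict Implicit.
Unset Printing Implicit Defensive.

Import GRing.Theory Num.Theory.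
Local Open Scope ring_scope.

(* The index set [n] is 'I_n, and a multi-index (i_1, ..., i_k) is a k-tuple
   t whose first entry is [ohead t] and whose other entries are [behead t]. *)
Definition tensor (K : Type) (k n : nat) : Type := k.-tuple 'I_n -> K.

Section Tensor.
Variables (K : fieldType) (k n : nat).
Implicit Types (A : tensor K k n) (lam : K) (x : 'rV[K]_n).

Definition symmetric_tensor A : Prop :=
  forall (t : k.-tuple 'I_n) (s : 'S_k), A [tuple tnth t (s i) | i < k] = A t.

(* (A x^{k-1})_i *)
Definition tensor_apply A x (i : 'I_n) : K :=
  \sum_(t : k.-tuple 'I_n | ohead t == Some i)
     A t * \prod_(j <- behead t) x 0 j.

Definition eigen_equation A lam x : Prop :=
  forall i : 'I_n, tensor_apply A x i = lam * x 0 i ^+ k.-1.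

Definition tensor_eigenvalue A lam : Prop :=
  exists2 x : 'rV[K]_n, x != 0 & eigen_equation A lam x.

Definition tensor_arc A : rel 'I_n := fun i j =>
  [exists t : k.-tuple 'I_n,
     [&& A t != 0, ohead t == Some i & j \in behead t]].

Definition weakly_irreducible A : Prop :=
  forall i j : 'I_n, connect (tensor_arc A) i j.

Definition is_edge A (e : {set 'I_n}) : bool :=
  [exists t : k.-tuple 'I_n, [&& A t != 0, uniq t & [set i in t] == e]].

(* c_e; for symmetric A, the value does not depend on the ordering t of e
   that is picked. *)
Definition edge_coef A (e : {set 'I_n}) : K :=
  if [pick t : k.-tuple 'I_n | uniq t && ([set i in t] == e)] is Some t
  then (k.-1)`!%:R * A t else 0.

End Tensor.

(* Points of the projective space P^{n-1} are represented by nonzero vectors,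
   two of which are the same point when they are proportional. Subsets of
   P^{n-1} are predicates on vectors, looked at on nonzero vectors only. *)
Section Projective.
Variables (K : fieldType) (n : nat).
Implicit Types (x y p : 'rV[K]_n) (V Z : 'rV[K]_n -> Prop).

Definition same_point x y : Prop := exists2 c : K, c != 0 & y = c *: x.

Definition zariski_closed Z : Prop :=
  exists G : {mpoly K[n]} -> Prop,
    (forall g, G g -> exists d : nat, g \is d.-homog) /\
    (forall x, x != 0 -> (Z x <-> forall g, G g -> g.@[fun i => x 0 i] = 0)).

(* p is an isolated point of V: some open set ~Z meets V in p only. *)
Definition isolated_point V p : Prop :=
  [/\ p != 0, V p &
      exists2 Z, zariski_closed Z &
        forall x, x != 0 -> (V x /\ ~ Z x <-> same_point p x)].

End Projective.

Section LocalRing.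
Variables (K : fieldType) (m : nat) (q : 'I_m -> K).
Local Notation S := {mpoly K[m]}.

(* S_{M_q}, as a subring of the fraction field of S *)
Definition in_local_ring (z : {fraction S}) : Prop :=
  exists a b : S, b.@[q] != 0 /\ z = tofrac a / tofrac b.

Definition in_local_ideal (n : nat) (f : 'I_n -> S) (z : {fraction S}) : Prop :=
  exists2 g : 'I_n -> {fraction S},
    forall i, in_local_ring (g i) & z = \sum_(i < n) g i * tofrac (f i).

(* dim_K (S_{M_q} / <f> S_{M_q}) = d: the classes of some e_1, ..., e_d in
   S_{M_q} form a basis of the quotient. *)
Definition local_quotient_dim (n : nat) (f : 'I_n -> S) (d : nat) : Prop :=
  exists e : 'I_d -> {fraction S},
    let comb (c : 'I_d -> K) := \sum_(i < d) tofrac (c i)%:MP * e i in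
    [/\ forall i, in_local_ring (e i),
        forall z, in_local_ring z ->
          exists c : 'I_d -> K, in_local_ideal f (z - comb c) &
        forall c : 'I_d -> K, in_local_ideal f (comb c) -> forall i, c i = 0].

End LocalRing.

Section Multiplicity.
Variables (K : fieldType) (k n : nat) (A : tensor K k n) (lam : K).

(* F_i *)
Definition eigen_poly (i : 'I_n) : {mpoly K[n]} :=
  lam *: 'X_i ^+ k.-1
  - \sum_(t : k.-tuple 'I_n | ohead t == Some i)
       A t *: \prod_(j <- behead t) 'X_j.

(* f_i: set x_j = 1. The remaining variable x_i, i != j, is renumbered along
   [lift j : 'I_n.-1 -> 'I_n]. *)
Definition chart_poly (j i : 'I_n) : {mpoly K[n.-1]} :=
  eigen_poly i \mPo
    [tuple (if unlift j l is Some l' then 'X_l' else 1) | l < n].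

Definition chart_point (p : 'rV[K]_n) (j : 'I_n) : 'I_n.-1 -> K :=
  fun i => p 0 (lift j i) / p 0 j.

Definition intersection_multiplicity (p : 'rV[K]_n) (d : nat) : Prop :=
  forall j : 'I_n, p 0 j != 0 ->
    local_quotient_dim (chart_point p j) (chart_poly j) d.

End Multiplicity.

(* e^{i alpha} *)
Definition expi (R : realType) (alpha : R) : complex R :=
  Complex (trigo.cos alpha) (trigo.sin alpha).

(* Main.v *)
(* Put a_t = A_t p_{t_1} ... p_{t_k}. By the eigen-equations at p, the kernel of
   the Jacobian at p of the chart equations consists of the tangent vectors
   whose logarithmic coordinates w (with w_j = 0 on the chart x_j = 1) satisfy
     sum_(t with head i) a_t * sum_(r in the tail of t) (w_i - w_r) = 0
   for all i. By the common phase the a_t may be replaced by |a_t| >= 0: this is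
   a weighted Laplacian, and by the maximum principle along D(A) its kernel
   consists of the constants. Hence w = 0, the Jacobian has full rank, and the
   local ideal is the maximal ideal. *)
Require Import Defs.
From mathcomp Require Import all_boot all_order all_fingroup all_algebra.
From mathcomp Require Import complex mpoly reals.
From mathcomp Require Import fraction ring.

Set Implicit Arguments.
Unset Strict Implicit.
Unset Printing Implicit Defensive.

Import GRing.Theory Num.Theory.
Local Open Scope ring_scope.

(** * First-order expansions and directional derivatives of polynomials *)

Section LinearTerm.
Variables (K : comNzRingType) (m : nat) (q : 'I_m -> K).
Local Notation S := {mpoly K[m]}.

(** Constants and variables have such an expansion, and it survives sums and products; for products,
    use [g1 g2 = (g1 - g1(q)) g2 + g1(q) g2]. *)
Lemma mpoly_hadamard (f : S) :
  exists h : 'I_m -> S, f = f.@[q]%:MP + \sum_i h i * ('X_i - (q i)%:MP).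
Proof.
pose P (g : S) := exists h : 'I_m -> S,
  g = g.@[q]%:MP + \sum_i h i * ('X_i - (q i)%:MP).
have PC c : P c%:MP.
  exists (fun=> 0); rewrite mevalC big1 ?addr0 // => i _; exact: mul0r.
have PX j : P 'X_j.
  exists (fun i => (i == j)%:R); rewrite mevalXU (bigD1 j) //= eqxx mul1r.
  rewrite big1 ?addr0 ?subrKC // => i /negPf ->; exact: mul0r.
have PD g1 g2 : P g1 -> P g2 -> P (g1 + g2).
  move=> [h1 e1] [h2 e2]; exists (fun i => h1 i + h2 i).
  rewrite {1}e1 {1}e2 mevalD mpolyCD addrACA -big_split /=.
  by congr (_ + _); apply: eq_bigr => i _; rewrite mulrDl.
have PM g1 g2 : P g1 -> P g2 -> P (g1 * g2).
  move=> [h1 e1] [h2 e2]; exists (fun i => h1 i * g2 + g1.@[q]%:MP * h2 i).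
  rewrite {1}e1 mulrDl {1}e2 mevalM mpolyCM mulrDr -addrA.
  congr (_ + _); rewrite mulr_sumr mulr_suml -big_split /=.
  by apply: eq_bigr => i _; ring.
elim/mpolyind: f => [|c a f _ _ Pf]; first by rewrite -mpolyC0; exact: PC.
apply: (PD) Pf; rewrite -mul_mpolyC; apply: (PM) => //; rewrite mpolyXE_id.
apply: (big_ind P) => [||i _]; [by rewrite -mpolyC1|exact: PM|].
by elim: (a i) => [|r IH]; rewrite ?expr0 ?exprS -?mpolyC1 //; exact: PM.
Qed.

Lemma mderivXU i j : ('X_i : S)^`M(j) = (i == j)%:R.
Proof.
rewrite mderivX mnm1E; case: eqP => [->|_]; last by rewrite scale0r.
by rewrite scale1r -[X in (X - _)%MM]add0m addmK mpolyX0.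
Qed.

(** Differentiating the expansion and evaluating at [q] kills every term that keeps a factor
    [X_i - q_i]. *)
Lemma mpoly_taylor1 (f : S) :
  exists2 h : 'I_m -> S, f = f.@[q]%:MP + \sum_i h i * ('X_i - (q i)%:MP) &
    forall i, (h i).@[q] = f^`M(i).@[q].
Proof.
have [h fE] := mpoly_hadamard f; exists h => // j.
have term i : (h i * ('X_i - (q i)%:MP))^`M(j).@[q] = (h i).@[q] * (i == j)%:R.
  rewrite mderivM mderivB mderivC mderivXU subr0 mevalD !mevalM mevalB mevalXU.
  by rewrite mevalC subrr mulr0 add0r -mpolyC_nat mevalC.
rewrite [in RHS]fE mderivD mderivC add0r (raddf_sum (mderiv j)).
rewrite (raddf_sum (meval q)) (bigD1 j) //= big1 => [|i /negPf ij].
  by rewrite addr0 term eqxx mulr1.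
by rewrite term ij mulr0.
Qed.

Variable v : 'I_m -> K.

Definition dirderiv (f : S) : K := \sum_i f^`M(i).@[q] * v i.

Lemma dirderivC c : dirderiv c%:MP = 0.
Proof. by apply: big1 => i _; rewrite mderivC meval0 mul0r. Qed.

Lemma dirderivXU i : dirderiv 'X_i = v i.
Proof.
rewrite /dirderiv (bigD1 i) //= big1 => [|l /negPf li].
  by rewrite addr0 mderivXU eqxx meval1 mul1r.
by rewrite mderivXU eq_sym li meval0 mul0r.
Qed.

Lemma dirderivB f g : dirderiv (f - g) = dirderiv f - dirderiv g.
Proof.
rewrite /dirderiv -sumrB; apply: eq_bigr => i _.
by rewrite mderivB mevalB mulrBl.
Qed.

Lemma dirderivZ c f : dirderiv (c *: f) = c * dirderiv f.
Proof.
rewrite /dirderiv mulr_sumr; apply: eq_bigr => i _.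
by rewrite mderivZ mevalZ mulrA.
Qed.

Lemma dirderiv_sum (I : Type) (s : seq I) (P : pred I) (F : I -> S) :
  dirderiv (\sum_(i <- s | P i) F i) = \sum_(i <- s | P i) dirderiv (F i).
Proof.
rewrite /dirderiv exchange_big; apply: eq_bigr => i _.
by rewrite (raddf_sum (mderiv i)) (raddf_sum (meval q)) mulr_suml.
Qed.

Lemma dirderivM f g :
  dirderiv (f * g) = dirderiv f * g.@[q] + f.@[q] * dirderiv g.
Proof.
rewrite /dirderiv mulr_suml mulr_sumr -big_split; apply: eq_bigr => i _.
by rewrite mderivM mevalD !mevalM /=; ring.
Qed.

(** Logarithmic product rule; the logarithmic derivatives [w] are given multiplicatively, so that no
    value of [F] has to be inverted. *)
Lemma dirderiv_prod (I : Type) (s : seq I) (F : I -> S) (w : I -> K) :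
  (forall j, dirderiv (F j) = (F j).@[q] * w j) ->
  dirderiv (\prod_(j <- s) F j)
  = (\prod_(j <- s) (F j).@[q]) * \sum_(j <- s) w j.
Proof.
move=> Fw; elim: s => [|j s IH].
  by rewrite !big_nil -mpolyC1 dirderivC mulr0.
by rewrite !big_cons dirderivM IH Fw rmorph_prod /=; ring.
Qed.

End LinearTerm.

(** * A full-rank Jacobian makes the local quotient one-dimensional *)

Section LocalRing.
Variables (K : fieldType) (m : nat) (q : 'I_m -> K).
Local Notation S := {mpoly K[m]}.

Lemma in_local_ring_tofrac (a : S) : in_local_ring q (tofrac a).
Proof.
by exists a, 1; rewrite meval1 oner_eq0 tofrac1 divr1; split.
Qed.

Lemma tofrac_unit (b : S) : b.@[q] != 0 -> tofrac b != 0.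
Proof. by apply: contraNneq => /eqP; rewrite tofrac_eq0 => /eqP ->; rewrite meval0. Qed.

Lemma in_local_ringM y z :
  in_local_ring q y -> in_local_ring q z -> in_local_ring q (y * z).
Proof.
move=> [a [b [b0 ->]]] [c [d [d0 ->]]]; exists (a * c), (b * d).
by rewrite mevalM mulf_neq0 // !tofracM invfM; split => //; ring.
Qed.

Lemma in_local_ringD y z :
  in_local_ring q y -> in_local_ring q z -> in_local_ring q (y + z).
Proof.
move=> [a [b [b0 ->]]] [c [d [d0 ->]]]; exists (a * d + c * b), (b * d).
rewrite mevalM mulf_neq0 //; split => //.
by rewrite addf_div ?tofrac_unit // tofracD !tofracM.
Qed.

Variables (n : nat) (f : 'I_n -> S).

Lemma in_local_idealM y z :
  in_local_ring q y -> in_local_ideal q f z -> in_local_ideal q f (y * z).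
Proof.
move=> Ly [g Lg ->]; exists (fun i => y * g i) => [i|].
  exact: in_local_ringM.
by rewrite mulr_sumr; apply: eq_bigr => i _; rewrite mulrA.
Qed.

Lemma in_local_ideal_sum (I : Type) (s : seq I) (P : pred I) F :
  (forall i, P i -> in_local_ideal q f (F i)) ->
  in_local_ideal q f (\sum_(i <- s | P i) F i).
Proof.
move=> HF; apply: big_ind => //.
  exists (fun=> 0) => [i|]; first by rewrite -tofrac0; exact: in_local_ring_tofrac.
  by rewrite big1 // => i _; rewrite mul0r.
move=> y z [g Lg ->] [h Lh ->]; exists (fun i => g i + h i) => [i|].
  exact: in_local_ringD.
by rewrite -big_split; apply: eq_bigr => i _; rewrite mulrDl.
Qed.

Hypothesis f_eq0 : forall i, (f i).@[q] = 0.

(** Fractions have no evaluation map at hand, so the denominators, nonzero at [q], are cleared to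
    reach an identity of polynomials. This will show that 1 is not in the local ideal. *)
Lemma local_ideal_eval0 (a : S) : in_local_ideal q f (tofrac a) -> a.@[q] = 0.
Proof.
case=> g Lg aE.
have /fin_all_exists2 [b b0 bE] : forall i, exists2 b : S, b.@[q] != 0 &
    exists c, g i * tofrac b = tofrac c.
  move=> i; have [c [b [b0 ->]]] := Lg i; exists b => //; exists c.
  by rewrite divfK ?tofrac_unit.
have {bE}/fin_all_exists [c cE] := bE.
have : a * \prod_i b i = \sum_i c i * (\prod_(j | j != i) b j) * f i.
  apply/eqP; rewrite -tofrac_eq tofracM aE rmorph_sum /= mulr_suml.
  apply/eqP/eq_bigr => i _; rewrite (bigD1 i) //= !tofracM -cE; ring.
move=> /(congr1 (meval q)); rewrite mevalM (raddf_sum (meval q)).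
have -> : \sum_i (c i * (\prod_(j | j != i) b j) * f i).@[q] = 0.
  by apply: big1 => i _; rewrite mevalM f_eq0 mulr0.
move=> /eqP; rewrite mulf_eq0 rmorph_prod /= => /orP[/eqP //|/eqP b0'].
suff /eqP[] : \prod_i (b i).@[q] != 0 by [].
by apply/prodf_neq0 => i _.
Qed.

Hypothesis jacobian_inj : forall v : 'I_m -> K,
  (forall i, dirderiv q v (f i) = 0) -> forall j, v j = 0.

(* Write f = H (X - q) with H(q) the Jacobian matrix, and pick a constant left
   inverse C of H(q). Then det (C H) is a unit of the local ring and Cramer's
   rule puts every X_i - q_i in the ideal. *)
Lemma coord_in_local_ideal j :
  in_local_ideal q f (tofrac ('X_j - (q j)%:MP)).
Proof.
have /fin_all_exists2 [h hE hq] := fun i => mpoly_taylor1 q (f i).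
pose H : 'M[S]_(n, m) := \matrix_(i, l) h i l.
pose J : 'M[K]_(n, m) := map_mx (meval q) H.
(* [J] has trivial kernel on columns, so its transpose has independent rows; this makes [pinvmx J] a
   left inverse of [J]. *)
have Jfull : row_full J.
  rewrite /row_full -mxrank_tr; apply: inj_row_free => v vJ.
  apply/rowP => l; rewrite mxE; apply: jacobian_inj => i.
  have := congr1 (fun M : 'rV_n => M 0 i) vJ; rewrite !mxE => e.
  by rewrite -[RHS]e; apply: eq_bigr => l' _; rewrite !mxE hq mulrC.
pose C : 'M[S]_(m, n) := map_mx (@mpolyC m K) (pinvmx J).
pose x : 'cV[S]_m := \col_l ('X_l - (q l)%:MP).
have HxE : H *m x = \col_i f i.
  apply/colP => i; rewrite !mxE [in RHS]hE f_eq0 mpolyC0 add0r.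
  by apply: eq_bigr => l _; rewrite !mxE.
have detE : (\det (C *m H)).@[q] = 1.
  rewrite -det_map_mx map_mxM -map_mx_comp (_ : map_mx _ _ = pinvmx J).
    by rewrite mulVpmx // det1.
  by apply/matrixP => ? ?; rewrite mxE /= mevalC.
have cramer : \det (C *m H) *: x = \adj (C *m H) *m C *m (\col_i f i).
  by rewrite -HxE mulmxA -[_ *m C *m H]mulmxA mul_adj_mx mul_scalar_mx.
have det0 : (\det (C *m H)).@[q] != 0 by rewrite detE oner_eq0.
exists (fun i => tofrac ((\adj (C *m H) *m C) j i) / tofrac (\det (C *m H))).
  by move=> i; exists ((\adj (C *m H) *m C) j i), (\det (C *m H)).
apply: (mulfI (tofrac_unit det0)); rewrite -tofracM.
have := congr1 (fun M : 'cV_m => M j 0) cramer.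
rewrite /x [LHS]mxE [in LHS]mxE => ->; rewrite mxE rmorph_sum mulr_sumr /=.
apply: eq_bigr => i _; rewrite [X in _ * X]mxE rmorphM /=.
by rewrite mulrA mulrCA divff ?mulr1 ?tofrac_unit.
Qed.

Lemma local_quotient_dim1 : local_quotient_dim q f 1.
Proof.
exists (fun=> 1); split=> [i|z [a [b [b0 zE]]]|c].
- by rewrite -tofrac1; exact: in_local_ring_tofrac.
(* The value of [z] at [q], chosen so that [a - c b] vanishes there and is a combination of the
   [X_i - q_i]. *)
- pose c := a.@[q] / b.@[q]; exists (fun=> c); rewrite big_ord1 mulr1.
  have [h] := mpoly_hadamard q (a - c%:MP * b).
  rewrite mevalB mevalM mevalC divfK // subrr mpolyC0 add0r => hE.
  have -> : z - tofrac c%:MP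
      = \sum_i (tofrac (h i) / tofrac b) * tofrac ('X_i - (q i)%:MP).
    apply: (mulIf (tofrac_unit b0)); rewrite mulrBl zE divfK ?tofrac_unit //.
    rewrite -tofracM -tofracB hE rmorph_sum mulr_suml /=.
    apply: eq_bigr => i _; rewrite tofracM.
    by rewrite mulrAC divfK ?tofrac_unit.
  apply: in_local_ideal_sum => i _; apply: in_local_idealM.
    by exists (h i), b.
  exact: coord_in_local_ideal.
- rewrite big_ord1 mulr1 => /local_ideal_eval0; rewrite mevalC => c0 i.
  by rewrite ord1.
Qed.

End LocalRing.

(** * Harmonic functions on a strongly connected weighted digraph *)

Section MaximumPrinciple.
Variables (F : realFieldType) (k n : nat) (b : tensor F k n).
Hypotheses (b_ge0 : forall t, 0 <= b t) (b_irr : weakly_irreducible b).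

(* At an index where w is maximal all terms of the sum are nonnegative, hence
   zero, so maximality propagates along the arcs. *)
Lemma weakly_irreducible_harmonic_const (w : 'I_n -> F) :
  (forall i, \sum_(t : k.-tuple 'I_n | ohead t == Some i)
               b t * \sum_(j <- behead t) (w i - w j) = 0) ->
  forall i j, w i = w j.
Proof.
move=> w_harm i0.
(* [i0] makes the index set nonempty, so [w] has a maximiser [i]. *)
have [i _ wi_max] := @Order.TotalTheory.arg_maxP _ _ _ i0 xpredT w isT.
suff w_const j : w j = w i by move=> j; rewrite !w_const.
have /connectP [s] := b_irr i j.
elim/last_ind: s j => [|s l IH] j; first by move=> _ ->.
rewrite rcons_path last_rcons => /andP[sP arc] ->.
have {IH sP} wlast := IH _ sP erefl.
have /existsP [t /and3P [t0 th lt]] := arc.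
have terms_ge0 (t' : k.-tuple 'I_n) : 0 <= \sum_(r <- behead t') (w (last i s) - w r).
  by apply: sumr_ge0 => r _; rewrite subr_ge0 wlast; exact: wi_max.
have /(_ t th)/eqP := psumr_eq0P (fun t' _ => mulr_ge0 (b_ge0 t') (terms_ge0 t'))
  (w_harm (last i s)).
rewrite mulf_eq0 (negPf t0) /= psumr_eq0; last first.
  by move=> r _; rewrite subr_ge0 wlast; exact: wi_max.
by move=> /allP/(_ l lt); rewrite /= subr_eq0 wlast => /eqP.
Qed.

End MaximumPrinciple.

(** * Values and derivatives of the eigen-equations in an affine chart *)

Section ChartDerivative.
Variables (K : fieldType) (k n : nat) (A : tensor K k n) (lam : K).
Variables (p : 'rV[K]_n) (j : 'I_n).
Hypotheses (p_neq0 : forall i, p 0 i != 0) (p_eig : eigen_equation A lam p).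

Let L (l : 'I_n) : {mpoly K[n.-1]} :=
  if unlift j l is Some l' then 'X_l' else 1.

Lemma chart_polyE i :
  chart_poly A lam j i = lam *: L i ^+ k.-1
    - \sum_(t : k.-tuple 'I_n | ohead t == Some i)
        A t *: \prod_(r <- behead t) L r.
Proof.
have LE l : 'X_l \mPo [tuple (if unlift j l is Some l' then 'X_l' else 1) | l < n]
    = L l by rewrite comp_mpolyXU -tnth_nth tnth_mktuple.
rewrite /chart_poly /eigen_poly comp_mpolyB comp_mpolyZ rmorphXn /= LE.
rewrite (raddf_sum (comp_mpoly _)); congr (_ - _); apply: eq_bigr => t _.
rewrite /= comp_mpolyZ rmorph_prod /=; congr (_ *: _).
by apply: eq_bigr => r _; rewrite LE.
Qed.

Let q := chart_point p j.

Lemma chart_coordE l : (L l).@[q] = p 0 l / p 0 j.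
Proof.
rewrite /L; case: unliftP => [l' ->|->]; first by rewrite mevalXU.
by rewrite meval1 divff.
Qed.

Lemma size_behead_ktuple (t : k.-tuple 'I_n) : size (behead t) = k.-1.
Proof. by rewrite size_behead size_tuple. Qed.

Lemma prod_chart_coord (t : k.-tuple 'I_n) :
  \prod_(r <- behead t) (L r).@[q]
  = (\prod_(r <- behead t) p 0 r) * p 0 j ^- k.-1.
Proof.
under eq_bigr do rewrite chart_coordE.
rewrite big_split /= big_const_seq count_predT size_behead_ktuple.
by rewrite -exprVn -Monoid.iteropE.
Qed.

Lemma chart_poly_eval i : (chart_poly A lam j i).@[q] = 0.
Proof.
rewrite chart_polyE mevalB mevalZ (rmorphXn (meval q)) /= chart_coordE.
rewrite expr_div_n mulrA -p_eig (raddf_sum (meval q)) mulr_suml -sumrB.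
apply: big1 => t _; rewrite /= mevalZ rmorph_prod /= prod_chart_coord; ring.
Qed.

(* Derivative of log (x_l) in direction v, where x_j = 1. *)
Definition log_dirderiv (v : 'I_n.-1 -> K) (l : 'I_n) : K :=
  if unlift j l is Some l' then v l' / (p 0 l / p 0 j) else 0.

Lemma chart_coord_dirderiv v l :
  dirderiv q v (L l) = (L l).@[q] * log_dirderiv v l.
Proof.
rewrite chart_coordE /L /log_dirderiv; case: unliftP => [l' ->|->].
  by rewrite dirderivXU mulrC divfK // mulf_neq0 ?invr_eq0.
by rewrite -mpolyC1 dirderivC mulr0.
Qed.

(** The eigen-equation at [p] turns [lam * p_i^(k-1)] into a sum over tuples; the [k-1] copies of
    the logarithmic derivative at [i] then pair with the [k-1] tail entries. *)
Lemma chart_poly_dirderiv v i :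
  dirderiv q v (chart_poly A lam j i) = p 0 j ^- k.-1 *
    \sum_(t : k.-tuple 'I_n | ohead t == Some i)
      A t * (\prod_(r <- behead t) p 0 r)
      * \sum_(r <- behead t) (log_dirderiv v i - log_dirderiv v r).
Proof.
(* As a product of equal factors, the power falls under the same logarithmic product rule as the
   monomials. *)
have powE (x : {mpoly K[n.-1]}) : x ^+ k.-1 = \prod_(r <- nseq k.-1 i) x.
  by rewrite big_const_seq count_predT size_nseq -Monoid.iteropE.
rewrite chart_polyE dirderivB dirderivZ dirderiv_sum powE.
rewrite (dirderiv_prod _ (fun=> chart_coord_dirderiv v i)).
rewrite -(rmorph_prod (meval q)) -powE rmorphXn /= chart_coordE expr_div_n.
rewrite mulrA [lam * _]mulrA -p_eig; set W := \sum_(r <- nseq _ _) _.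
rewrite [RHS]mulr_sumr !mulr_suml -sumrB; apply: eq_bigr => t _; rewrite dirderivZ.
rewrite (dirderiv_prod _ (chart_coord_dirderiv v)) prod_chart_coord.
rewrite /W [in RHS]sumrB !big_const_seq !count_predT size_nseq size_behead_ktuple.
ring.
Qed.

End ChartDerivative.

(** * Edge coefficients of a symmetric tensor *)

Section EdgePhase.
Variables (K : fieldType) (k n : nat) (A : tensor K k n).
Hypothesis A_sym : symmetric_tensor A.

(** Duplicate-free tuples with the same entries differ by a permutation, so symmetry makes the
    picked ordering harmless. *)
Lemma edge_coefE (t : k.-tuple 'I_n) : uniq t ->
  edge_coef A [set i in t] = (k.-1)`!%:R * A t.
Proof.
move=> t_uniq; rewrite /edge_coef; case: pickP => [t' /andP[t'_uniq /eqP t't]|].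
  have /tuple_permP[s /val_inj ->] : perm_eq t' t.
    by apply: uniq_perm => // i; have := in_set (mem t) i; rewrite -t't inE.
  by rewrite A_sym.
by move=> /(_ t); rewrite t_uniq eqxx.
Qed.

Lemma is_edge_set (t : k.-tuple 'I_n) :
  A t != 0 -> uniq t -> is_edge A [set i in t].
Proof. by move=> t0 t_uniq; apply/existsP; exists t; rewrite t0 t_uniq eqxx. Qed.

End EdgePhase.

Lemma expi_neq0 (R : realType) (alpha : R) : expi alpha != 0.
Proof.
apply/eqP => -[c0 s0]; have := trigo.cos2Dsin2 alpha.
by rewrite c0 s0 expr0n addr0 => /eqP; rewrite eq_sym oner_eq0.
Qed.

(** * Reduction from a common phase to nonnegative real weights *)

Section CommonPhase.
Variables (R : realType) (k n : nat) (A : tensor (complex R) k n).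
Hypotheses (A_irr : weakly_irreducible A) (A_sym : symmetric_tensor A).
Hypothesis A_supp : forall t : k.-tuple 'I_n, A t != 0 -> constant t || uniq t.
Variables (p : 'rV[complex R]_n) (alpha : R).
Hypothesis p_neq0 : forall i, p 0 i != 0.
Hypothesis p_phase : forall e : {set 'I_n}, is_edge A e ->
  edge_coef A e * \prod_(i in e) p 0 i
  = `| edge_coef A e * \prod_(i in e) p 0 i | * expi alpha.

Let a (t : k.-tuple 'I_n) := A t * \prod_(r <- t) p 0 r.

(** The phase hypothesis on the edge of [t] differs only by the positive factor [(k-1)!], which
    cancels. *)
Lemma uniq_tuple_phase (t : k.-tuple 'I_n) : uniq t -> a t = `|a t| * expi alpha.
Proof.
move=> t_uniq; have [t0|t0] := eqVneq (A t) 0; first by rewrite /a t0 mul0r normr0 mul0r.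
have := p_phase (is_edge_set t0 t_uniq); rewrite edge_coefE //.
have -> : \prod_(i in [set i in t]) p 0 i = \prod_(r <- t) p 0 r.
  by rewrite big_uniq //; apply: eq_bigl => i; rewrite inE.
rewrite -mulrA normrM normr_nat -mulrA; apply: mulfI.
by rewrite pnatr_eq0 -lt0n fact_gt0.
Qed.

(** Once the weights are real, the real and imaginary parts of [w] are harmonic separately, and the
    maximum principle applies to each. *)
Lemma common_phase_harmonic_const (w : 'I_n -> complex R) :
  (forall i, \sum_(t : k.-tuple 'I_n | ohead t == Some i)
               a t * \sum_(r <- behead t) (w i - w r) = 0) ->
  forall i j, w i = w j.
Proof.
move=> w_harm; pose b t : R := complex.Re `|a t|.
have bE t : `|a t| = real_complex R (b t) by rewrite /b normc_def.
have b_ge0 t : 0 <= b t by rewrite /b normc_def /= sqrtr_ge0.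
(* As [p] has no zero entry, [b] and [A] have the same support, hence the same digraph. *)
have b_eq0 t : (b t != 0) = (A t != 0).
  have a0 : (a t == 0) = (A t == 0).
    rewrite mulf_eq0 orbC (negPf (_ : \prod_(r <- t) p 0 r != 0)) //.
    by rewrite prodf_seq_neq0; apply/allP => r _; exact: p_neq0.
  by rewrite -a0 -(normr_eq0 (a t)) bE fmorph_eq0.
have b_irr : weakly_irreducible b.
  move=> i j; rewrite -(eq_connect (e := tensor_arc A)) // => x y.
  by apply: eq_existsb => t; rewrite b_eq0.
have b_harm i : \sum_(t : k.-tuple 'I_n | ohead t == Some i)
    real_complex R (b t) * \sum_(r <- behead t) (w i - w r) = 0.
  apply: (mulIf (expi_neq0 alpha)); rewrite mul0r -[RHS](w_harm i) mulr_suml.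
  apply: eq_bigr => t /eqP ti; rewrite -bE mulrAC.
  (* The phase is known on duplicate-free tuples only; in a constant tuple every tail index equals
     [i], so the inner sum is zero. *)
  have [t0|/A_supp /orP[t_const|/uniq_tuple_phase <- //]] := eqVneq (A t) 0.
    by rewrite /a t0 !mul0r normr0 !mul0r.
  rewrite (_ : \sum_(r <- behead t) _ = 0) ?mulr0 //.
  apply: big1_seq => r; case: (tval t) ti t_const => //= x s [->].
  by move=> /allP s_i /s_i /eqP ->; rewrite subrr.
have part_const (g : complex R -> R) :
    (forall x y, g (x + y) = g x + g y) -> (forall x y, g (x - y) = g x - g y) ->
    g 0 = 0 -> (forall c x, g (real_complex R c * x) = c * g x) ->
    forall i j, g (w i) = g (w j).
  move=> gD gB g0 gZ; apply: (weakly_irreducible_harmonic_const b_ge0 b_irr) => i.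
  rewrite -[RHS]g0 -(b_harm i) (big_morph g gD g0); apply: eq_bigr => t _.
  by rewrite gZ (big_morph g gD g0); congr (_ * _); apply: eq_bigr.
move=> i j; rewrite [w i]complexE [w j]complexE; congr (_ + 'i * _)%C.
  congr (real_complex R _); apply: (part_const (@complex.Re R)) => //.
  - by move=> [? ?] [? ?].
  - by move=> [? ?] [? ?].
  - by move=> c [? ?] /=; rewrite mul0r subr0.
congr (real_complex R _); apply: (part_const (@complex.Im R)) => //.
- by move=> [? ?] [? ?].
- by move=> [? ?] [? ?].
- by move=> c [? ?] /=; rewrite mul0r addr0.
Qed.

End CommonPhase.

Theorem lemma5p3 (R : realType) (k n : nat) (hk : (2 <= k)%N) (hn : (2 <= n)%N)
    (A : tensor (complex R) k n)
    (hirr : weakly_irreducible A)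
    (hsym : symmetric_tensor A)
    (hsupp : forall t : k.-tuple 'I_n, A t != 0 -> constant t || uniq t)
    (lam : complex R) (hlam : tensor_eigenvalue A lam)
    (p : 'rV[complex R]_n)
    (hp : isolated_point (eigen_equation A lam) p)
    (hnz : forall i : 'I_n, p 0 i != 0)
    (halpha : exists alpha : R, forall e : {set 'I_n}, is_edge A e ->
       edge_coef A e * \prod_(i in e) p 0 i
       = `| edge_coef A e * \prod_(i in e) p 0 i | * expi alpha) :
  intersection_multiplicity A lam p 1%N.
Proof.
case: hp => _ p_eig _ j pj; case: halpha => alpha p_phase.
apply: local_quotient_dim1 => [i|v v_ker l]; first exact: chart_poly_eval.
have w_const : forall i i', log_dirderiv p j v i = log_dirderiv p j v i'.
  apply: (common_phase_harmonic_const hirr hsym hsupp hnz p_phase) => i.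
  have := v_ker i; rewrite chart_poly_dirderiv // => /eqP.
  rewrite mulf_eq0 invr_eq0 expf_eq0 (negPf pj) andbF /= => /eqP e.
  (* Multiplying the [i]-th equation by [p_i] completes each tail product to the product over the
     whole tuple. *)
  apply: etrans (mulr0 (p 0 i)); rewrite -[in RHS]e mulr_sumr.
  apply: eq_bigr => t /eqP ti.
  have -> : \prod_(r <- t) p 0 r = p 0 i * \prod_(r <- behead t) p 0 r.
    by case: (tval t) ti => //= x s [->]; rewrite big_cons.
  by rewrite mulrCA !mulrA.
(* The logarithmic coordinate at [j] is 0, since [x_j = 1] is fixed on the chart; hence so are all
   the others. *)
have := w_const (lift j l) j; rewrite /log_dirderiv liftK unlift_none => /eqP.
by rewrite mulf_eq0 invr_eq0 mulf_eq0 invr_eq0 !(negPf (hnz _)) !orbF => /eqP.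
Qed.
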